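(* Let $a$ and $b$ be odd positive integers. Then $$2^{ab}+1=(2^a+1)\sum_{i=0}^{b-1}(-2)^{ia}.$$ *)

(* Defs.v *)
From mathcomp Require Import all_boot all_order all_algebra.

Set Implicit Arguments.
Unset Strict Implicit.
Unset Printing Implicit Defensive.

(* Main.v *)
Require Import Defs.
From mathcomp Require Import all_boot all_order all_algebra.

Local Open Scope ring_scope.

Theorem proposition2 (a b : nat)
    (a_gt0 : (0 < a)%N) (a_odd : odd a) (b_gt0 : (0 < b)%N) (b_odd : odd b) :
  2 ^+ (a * b) + 1 = (2 ^+ a + 1) * \sum_(0 <= i < b) (- 2) ^+ (i * a) :> int.
Proof.
(* Up to sign this is the geometric sum x ^+ b - 1 = (x - 1) * \sum_i x ^+ i
   at x = (-2) ^+ a: as a and b are odd, x = - 2 ^+ a and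
   x ^+ b = - 2 ^+ (a * b). *)
have oddN n : odd n -> (- 2) ^+ n = - 2 ^+ n :> int.
  by move=> n_odd; rewrite GRing.exprNn -GRing.signr_odd n_odd GRing.mulN1r.
have := GRing.subrX1 ((- 2) ^+ a : int) b.
rewrite -GRing.exprM !oddN ?oddM ?a_odd // -!GRing.opprD GRing.mulNr.
move/GRing.oppr_inj->; congr (_ * _); rewrite big_mkord.
by apply: eq_bigr => i _; rewrite -oddN // -GRing.exprM mulnC.
Qed.
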